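(* Let $(E_i)_{i\ge1}$ be subsets of $\mathbb{N}$ such that $E=\bigcup_{i\ge1}E_i$ is taut, let $(A_i)_{i\ge1}$ be Behrend sets, and let $B=\bigcup_{i\ge1}E_iA_i$. Then $B'=E$.
   Context: $\mathbb{N}=\{1,2,\dots\}$. For $X,Y\subseteq\mathbb{N}$ and $c\in\mathbb{N}$, $XY=\{xy:x\in X,y\in Y\}$ and $cX=\{cx:x\in X\}$. For $B\subseteq\mathbb{N}$ let $\mathcal{M}_B=\bigcup_{b\in B}b\mathbb{Z}$. For $A\subseteq\mathbb{Z}$ the logarithmic density is $\delta(A)=\lim_{n\to\infty}\frac{1}{\ln n}\sum_{1\le k\le n,\,k\in A}\frac1k$; $\delta(\mathcal{M}_B)$ exists for every $B\subseteq\mathbb{N}$ (Davenport--Erdős). $B$ is taut if $\delta(\mathcal{M}_{B\setminus\{b\}})<\delta(\mathcal{M}_B)$ for every $b\in B$. $B$ is Behrend if $B\subseteq\mathbb{N}\setminus\{1\}$ and $\delta(\mathcal{M}_B)=1$. $B^{prim}=B\setminus\bigcup_{k\ge2}kB$. Tautification: put $C(B)=\{c\in\mathbb{N}: cA\subseteq B\text{ for some Behrend set }A\}$; the tautification of $B$ is $B'=(B\cup C(B))^{prim}$. (Equivalently, $B'$ is the unique taut set whose Mirsky measure equals that of $B$, where the Mirsky measure of $B$ is the shift-invariant measure on $\{0,1\}^{\mathbb{Z}}$ for which $\mathbf{1}_{\mathbb{Z}\setminus\mathcal{M}_B}$ is quasi-generic along any sequence realizing the lower density of $\mathcal{M}_B$.)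 *)

(* Defs.v *)
From mathcomp Require Import all_boot all_order all_algebra.
From mathcomp Require Import all_classical all_reals all_analysis.
Set Implicit Arguments.
Unset Strict Implicit.
Unset Printing Implicit Defensive.
Import Order.TTheory GRing.Theory Num.Theory.
Import numFieldNormedType.Exports.
Local Open Scope classical_set_scope.
Local Open Scope ring_scope.

(* Sets of positive integers are represented as [set nat], positivity being
   stated by inclusion in [posnat]. *)
Definition posnat : set nat := [set n | (0 < n)%N].

Definition prodset (X Y : set nat) : set nat :=
  [set (x * y)%N | x in X & y in Y].

Definition dilate (c : nat) (X : set nat) : set nat := [set (c * x)%N | x in X].

Definition multiples (B : set nat) : set int :=
  \bigcup_(b in B) range (fun z : int => b%:Z * z).

Definition logmean (R : realType) (A : set int) (n : nat) : R :=
  (ln n%:R)^-1 * \sum_(1 <= k < n.+1 | k%:Z \in A) k%:R^-1.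

(* [lim] is total; for [A = multiples B] the limit exists by the
   Davenport-Erdos theorem. *)
Definition logdensity (R : realType) (A : set int) : R :=
  lim (logmean R A @ \oo).

Definition taut (R : realType) (B : set nat) : Prop :=
  forall b, B b ->
    logdensity R (multiples (B `\ b)) < logdensity R (multiples B).

Definition Behrend (R : realType) (B : set nat) : Prop :=
  B `<=` posnat `\ 1%N /\ logdensity R (multiples B) = 1.

Definition prim (B : set nat) : set nat :=
  B `\` \bigcup_(k in [set k | (2 <= k)%N]) dilate k B.

Definition Behrend_cofactors (R : realType) (B : set nat) : set nat :=
  [set c | posnat c /\ exists2 A, Behrend R A & dilate c A `<=` B].

Definition tautification (R : realType) (B : set nat) : set nat :=
  prim (B `|` Behrend_cofactors R B).

(* Main.v *)
(* Give a divisor [d] of [N] the weight [1 / d]. This weight is multiplicative,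
   so Harris' inequality holds: functions monotone for divisibility are
   correlated. Applied to the indicator of a divisor-closed set [D] against
   [d <= n], and against harmonic sums of integers coprime to [N / d], it shows
   that [D] has logarithmic density 0 iff its proportion among the divisors of
   [N] can be made arbitrarily small (a form of Davenport-Erdos). Applied to two
   divisor-closed sets it shows that if a finite union of sets of integers has
   multiples of density 1, then so does one of the sets (Behrend).
   Now let [E] be taut and [c A] consist of multiples of [E] with [A] Behrend.
   Every [a] in [A] is a multiple of some [e / gcd (e, c)], so if no [e] divides
   [c] then for some divisor [d] of [c] the quotients by [d] of the elements of
   [E] form a Behrend set, and they still do when one is removed: removing [d q]
   from [E] does not change the density of the multiples, contradicting
   tautness. Hence everything in [B] or [C(B)] is a multiple of an element of
   [E], while [E] is a primitive subset of [C(B)]. *)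
Require Import Defs.
From mathcomp Require Import all_boot all_order all_algebra.
From mathcomp Require Import all_classical all_reals all_analysis.
From mathcomp Require Import ring lra zify.
Set Implicit Arguments.
Unset Strict Implicit.
Unset Printing Implicit Defensive.
Import Order.TTheory GRing.Theory Num.Theory.
Import numFieldNormedType.Exports.
Local Open Scope classical_set_scope.
Local Open Scope ring_scope.

(** * Divisor sums with weight [1 / d] and Harris' inequality *)

Definition divisor_sum (R : realType) (f : nat -> R) (N : nat) : R :=
  \sum_(d <- divisors N) f d / d%:R.

Definition div_antitone (R : realType) (N : nat) (f : nat -> R) : Prop :=
  forall m n, (m %| n)%N -> (n %| N)%N -> f n <= f m.

(** Summing [w i * w j * (F i - F j) * (G i - G j)] over all pairs gives a nonnegative number, which
    expands to twice the difference of the two sides. *)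
Lemma chebyshev_sum (R : realDomainType) (I : eqType) (s : seq I)
    (w F G : I -> R) :
  (forall i, i \in s -> 0 <= w i) ->
  {in s &, forall i j, 0 <= (F i - F j) * (G i - G j)} ->
  (\sum_(i <- s) w i * F i) * (\sum_(i <- s) w i * G i) <=
  (\sum_(i <- s) w i * (F i * G i)) * (\sum_(i <- s) w i).
Proof.
move=> w0 FG.
have : 0 <= \sum_(i <- s) \sum_(j <- s)
    w i * w j * ((F i - F j) * (G i - G j)).
  rewrite big_seq; apply: sumr_ge0 => i si.
  rewrite big_seq; apply: sumr_ge0 => j sj.
  by apply: mulr_ge0; [apply: mulr_ge0; exact: w0 | exact: FG].
pose T (u v : I -> R) := (\sum_(i <- s) w i * u i) * (\sum_(j <- s) w j * v j).
have TE u v : T u v = \sum_(i <- s) \sum_(j <- s) w i * w j * (u i * v j).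
  rewrite /T mulr_suml; apply: eq_bigr => i _; rewrite mulr_sumr.
  by apply: eq_bigr => j _; ring.
have -> : \sum_(i <- s) \sum_(j <- s) w i * w j * ((F i - F j) * (G i - G j)) =
  T (fun i => F i * G i) (fun=> 1) - T F G - T G F
  + T (fun=> 1) (fun i => F i * G i).
  rewrite !TE -!sumrN -!big_split /=; apply: eq_bigr => i _.
  by rewrite -!sumrN -!big_split /=; apply: eq_bigr => j _; ring.
rewrite /T.
have -> : \sum_(i <- s) w i * 1 = \sum_(i <- s) w i.
  by apply: eq_bigr => i _; rewrite mulr1.
set a := \sum_(i <- s) _; set b := \sum_(i <- s) w i.
set c := \sum_(i <- s) _; set d := \sum_(i <- s) w i * G i.
lra.
Qed.

Lemma perm_divisors_prime_mul (p k M : nat) :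
  prime p -> (0 < M)%N -> coprime p M ->
  perm_eq (divisors (p ^ k * M))
    [seq (p ^ j * d)%N | j <- iota 0 k.+1, d <- divisors M].
Proof.
move=> pp M0 cpM.
have p0 : (0 < p)%N by exact: prime_gt0.
have pk0 j : (0 < p ^ j)%N by rewrite expn_gt0 p0.
have lp j d : (d %| M)%N -> logn p (p ^ j * d) = j.
  move=> dM; have d0 : (0 < d)%N by apply: dvdn_gt0 dM.
  rewrite lognM ?pk0 // pfactorK // (@logn_coprime p d) ?addn0 //.
  exact: coprime_dvdr dM cpM.
apply: uniq_perm; first exact: divisors_uniq.
  apply: allpairs_uniq; rewrite ?iota_uniq ?divisors_uniq //.
  (* The exponent [j] is recovered as the [p]-adic valuation of [p ^ j * d], and then [d] by
     cancellation. *)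
  move=> [j d] [j' d'] /allpairsP[[a b] [_ + [-> ->]]].
  move=> + /allpairsP[[a' b'] [_ + [-> ->]]] => /= bM b'M e.
  rewrite -!dvdn_divisors // in bM b'M.
  have ea : a = a' by rewrite -(lp a b) // e lp.
  by move: e; rewrite ea => /eqP; rewrite eqn_pmul2l // => /eqP ->.
move=> n; rewrite -dvdn_divisors ?muln_gt0 ?pk0 //.
apply/idP/idP => [nN|/allpairsP[[a b] [ha hb ->]]]; last first.
  move: ha hb; rewrite mem_iota -dvdn_divisors // => /andP[_ ak] bM.
  by rewrite dvdn_mul // dvdn_exp2l.
have c : coprime (p ^ k) M by exact: coprimeXl.
have /dvdn_pfactor := dvdn_gcdr n (p ^ k).
case/(_ pp) => j jk ej.
(* A divisor [n] of [p ^ k * M] is the product of its gcds with the two coprime factors. *)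
apply/allpairsP; exists (j, gcdn n M); split; rewrite ?mem_iota //.
  by rewrite -dvdn_divisors // dvdn_gcdr.
rewrite -ej /=; apply/eqP; rewrite eqn_dvd; apply/andP; split.
  rewrite muln_gcdr !muln_gcdl !dvdn_gcd.
  by rewrite (dvdn_mulr n) // (dvdn_mulr M) // (dvdn_mull (p ^ k)).
rewrite Gauss_dvd ?dvdn_gcdl //.
by apply: coprime_dvdl (dvdn_gcdr _ _) _; apply: coprime_dvdr (dvdn_gcdr _ _) c.
Qed.

Lemma divisor_sum_prime_mul (R : realType) (f : nat -> R) (p k M : nat) :
  prime p -> (0 < M)%N -> coprime p M ->
  divisor_sum f (p ^ k * M) =
  \sum_(j <- iota 0 k.+1)
    (p ^ j)%:R^-1 * divisor_sum (fun d => f (p ^ j * d)%N) M.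
Proof.
move=> pp M0 c; rewrite /divisor_sum.
rewrite (perm_big _ (perm_divisors_prime_mul k pp M0 c)).
rewrite big_allpairs_dep; apply: eq_bigr => j _; rewrite mulr_sumr.
by apply: eq_bigr => d _; rewrite natrM invfM; ring.
Qed.

Lemma divisor_sum_ge0 (R : realType) (f : nat -> R) (N : nat) :
  (forall d, (d %| N)%N -> 0 <= f d) -> (0 < N)%N -> 0 <= divisor_sum f N.
Proof.
move=> f0 N0; rewrite /divisor_sum big_seq; apply: sumr_ge0 => d.
by rewrite -dvdn_divisors // => dN; rewrite divr_ge0 ?f0.
Qed.

Lemma ler_divisor_sum (R : realType) (f g : nat -> R) (N : nat) :
  (0 < N)%N -> (forall d, (d %| N)%N -> f d <= g d) ->
  divisor_sum f N <= divisor_sum g N.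
Proof.
move=> N0 fg; rewrite /divisor_sum big_seq [leRHS]big_seq; apply: ler_sum => d.
by rewrite -dvdn_divisors // => dN; rewrite ler_wpM2r ?fg.
Qed.

Lemma divisor_sum1_gt0 (R : realType) (N : nat) :
  (0 < N)%N -> 0 < divisor_sum (fun=> 1 : R) N.
Proof.
move=> N0; rewrite /divisor_sum.
have /perm_to_rem e : 1%N \in divisors N by rewrite -dvdn_divisors.
rewrite (perm_big _ e) big_cons /= divr1 ltr_pwDl // sumr_ge0 //.
Qed.

(* Harris' inequality: conditioning on the exponent of one prime reduces it to
   Chebyshev's sum inequality in that exponent. *)
Lemma divisor_sum_harris (R : realType) (f g : nat -> R) (N : nat) :
  (0 < N)%N -> div_antitone N f -> div_antitone N g ->
  divisor_sum f N * divisor_sum g N <=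
  divisor_sum (fun d => f d * g d) N * divisor_sum (fun=> 1) N.
Proof.
elim/ltn_ind: N f g => N IH f g N0 fN gN.
have [N1|N1] := leqP N 1.
  have -> : N = 1%N by lia.
  by rewrite /divisor_sum /divisors /= !big_seq1 !divr1 mulr1.
pose p := pdiv N; have pp : prime p by exact: pdiv_prime.
have [M cpM eN] := pfactor_coprime pp N0.
set k := logn p N in eN.
have k0 : (0 < k)%N by rewrite logn_gt0 mem_primes pp N0 pdiv_dvd.
have M0 : (0 < M)%N by move: N0; rewrite eN; case: (M).
have MN : (M < N)%N.
  by rewrite eN -[ltnLHS]muln1 ltn_pmul2l // -(exp1n k) ltn_exp2r ?prime_gt1.
have eN' : N = (p ^ k * M)%N by rewrite eN mulnC.
have jN j d : j \in iota 0 k.+1 -> (d %| M)%N -> (p ^ j * d %| N)%N.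
  by rewrite mem_iota eN' => jk dM; rewrite dvdn_mul // dvdn_exp2l //; lia.
have antij (h : nat -> R) j : div_antitone N h -> j \in iota 0 k.+1 ->
    div_antitone M (fun d => h (p ^ j * d)%N).
  by move=> hN jk m n mn nM; apply: hN; [rewrite dvdn_mul | exact: jN].
have mono (h : nat -> R) i j : div_antitone N h -> i \in iota 0 k.+1 ->
    j \in iota 0 k.+1 -> (i <= j)%N ->
    divisor_sum (fun d => h (p ^ j * d)%N) M <=
    divisor_sum (fun d => h (p ^ i * d)%N) M.
  move=> hN ik jk ij; apply: ler_divisor_sum => // d dM; apply: hN.
    by rewrite dvdn_mul // dvdn_exp2l.
  exact: jN.
rewrite eN' !divisor_sum_prime_mul //.
set c := divisor_sum (fun=> 1) M.
have c0 : 0 < c by exact: divisor_sum1_gt0.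
apply: le_trans (chebyshev_sum _ _) _.
- by move=> j _; rewrite invr_ge0.
- move=> i j ik jk; have [ij|/ltnW ij] := leqP i j.
    by rewrite mulr_ge0 // subr_ge0 mono.
  by rewrite mulr_le0 // subr_le0 mono.
(* The total weight is a common factor of both sides; what remains holds term by term by the
   induction hypothesis for [M]. *)
rewrite -mulr_suml [leRHS]mulrCA [leLHS]mulrC.
apply: ler_wpM2l; first by rewrite sumr_ge0 // => j _; rewrite invr_ge0.
rewrite mulr_suml big_seq [leRHS]big_seq; apply: ler_sum => j jk.
rewrite -mulrA ler_wpM2l ?invr_ge0 //.
by apply: (IH _ MN _ _ M0); exact: antij.
Qed.

(** * Harmonic sums compared with divisor sums *)

Definition harmonic_sum (R : realType) (f : nat -> R) (n : nat) : R :=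
  \sum_(1 <= k < n.+1) f k / k%:R.

Lemma ler_harmonic_sum (R : realType) (f g : nat -> R) (n : nat) :
  (forall k, (0 < k)%N -> f k <= g k) -> harmonic_sum f n <= harmonic_sum g n.
Proof.
move=> fg; apply: ler_sum_nat => k /andP[k0 _].
by rewrite ler_wpM2r ?fg.
Qed.

Lemma harmonic_sum_homo (R : realType) (f : nat -> R) (m n : nat) :
  (forall k, 0 <= f k) -> (m <= n)%N -> harmonic_sum f m <= harmonic_sum f n.
Proof.
move=> f0 mn; rewrite /harmonic_sum [leRHS](@big_cat_nat _ _ _ m.+1) //=.
by rewrite lerDl sumr_ge0 // => k _; rewrite divr_ge0.
Qed.

Lemma harmonic_sum_ge0 (R : realType) (f : nat -> R) (n : nat) :
  (forall k, 0 <= f k) -> 0 <= harmonic_sum f n.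
Proof. by move=> f0; rewrite sumr_ge0 // => k _; rewrite divr_ge0. Qed.

Lemma big_nat_multiples (R : nmodType) (d n : nat) (P : pred nat)
    (F : nat -> R) : (0 < d)%N ->
  \sum_(1 <= k < n.+1 | (d %| k)%N && P k) F k =
  \sum_(1 <= m < (n %/ d).+1 | P (d * m)%N) F (d * m)%N.
Proof.
move=> d0; rewrite -big_filter_cond -[RHS](big_map (muln d) P F).
apply: perm_big; apply: uniq_perm.
- by rewrite filter_uniq ?iota_uniq.
- rewrite map_inj_uniq ?iota_uniq // => i j /eqP.
  by rewrite eqn_pmul2l // => /eqP.
move=> k; rewrite mem_filter mem_index_iota; apply/andP/mapP.
  case=> /dvdnP[m ->] hm; exists m; last by rewrite mulnC.
  rewrite mem_index_iota ltnS leq_divRL // -ltnS; lia.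
case=> m; rewrite mem_index_iota ltnS leq_divRL // => hm ->.
by rewrite dvdn_mulr //; split => //; rewrite muln_gt0 d0; lia.
Qed.

(** The integers [k] are grouped by [d = gcdn k N]: those in one class are the [d * m] with [m]
    coprime to [N %/ d]. *)
Lemma harmonic_sum_gcd (R : realType) (f : nat -> R) (N n : nat) :
  (0 < N)%N ->
  harmonic_sum (fun k => f (gcdn k N)) n =
  divisor_sum (fun d => f d *
    \sum_(1 <= m < (n %/ d).+1 | coprime m (N %/ d)) m%:R^-1) N.
Proof.
move=> N0; rewrite /harmonic_sum /divisor_sum.
transitivity (\sum_(1 <= k < n.+1) \sum_(d <- divisors N | gcdn k N == d)
    f d / k%:R).
  apply: eq_bigr => k _; rewrite -big_filter.
  rewrite (@perm_big _ _ _ _ _ [:: gcdn k N]) ?big_seq1 //.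
  apply: uniq_perm; rewrite ?filter_uniq ?divisors_uniq // => d.
  rewrite mem_filter inE eq_sym; case: eqP => //= ->.
  by rewrite -dvdn_divisors // dvdn_gcdr.
rewrite (exchange_big_dep predT) //= big_seq [RHS]big_seq.
apply: eq_bigr => d; rewrite -dvdn_divisors // => dN.
have d0 : (0 < d)%N by apply: dvdn_gt0 dN.
(* The redundant condition [d %| k] allows reindexing by [k = d * m]. *)
have e k : (gcdn k N == d) = (d %| k)%N && (gcdn k N == d).
  by case: eqP => [<-|]; rewrite ?dvdn_gcdl ?andbF.
under eq_bigl do rewrite e.
rewrite big_nat_multiples // mulr_sumr mulr_suml.
apply: eq_big => [m|m _]; last by rewrite natrM invfM; ring.
have -> : gcdn (d * m) N = (d * gcdn m (N %/ d))%N.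
  by rewrite muln_gcdr mulnC [(d * (N %/ d))%N]mulnC divnK // mulnC.
by rewrite -[X in _ == X]muln1 eqn_pmul2l.
Qed.

Lemma ler_sum_coprime (R : realType) (M n n' : nat) : (n <= n')%N ->
  \sum_(1 <= m < n.+1 | coprime m M) (m%:R : R)^-1 <=
  \sum_(1 <= m < n'.+1 | coprime m M) m%:R^-1.
Proof.
move=> nn; rewrite [leRHS](@big_cat_nat _ _ _ n.+1) //=.
by rewrite lerDl sumr_ge0 // => k _; rewrite invr_ge0.
Qed.

(* With [c d] the harmonic sum over [m <= n] coprime to [N / d], which is
   monotone in [d], the left-hand sum is at most the divisor sum of [f * c],
   and Harris' inequality decouples the two factors. *)
Lemma harmonic_sum_le_divisor_mean (R : realType) (f : nat -> R) (N n : nat) :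
  (0 < N)%N -> (forall k, 0 <= f k) ->
  (forall m k, (m %| k)%N -> f k <= f m) ->
  harmonic_sum f n * divisor_sum (fun=> 1) N <=
  divisor_sum f N * harmonic_sum (fun=> 1) (n * N).
Proof.
move=> N0 f0 fa.
pose c d : R := \sum_(1 <= m < n.+1 | coprime m (N %/ d)) m%:R^-1.
(* Up to [n * N] the inner range reaches [n * N %/ d], which is at least [n] for every divisor [d]
   of [N]. *)
have cE : divisor_sum c N <= harmonic_sum (fun=> 1) (n * N).
  rewrite (harmonic_sum_gcd (fun=> 1) _ N0); apply: ler_divisor_sum => // d dN.
  rewrite mul1r; apply: ler_sum_coprime.
  by rewrite leq_divRL ?(dvdn_gt0 N0 dN) // leq_mul2l (dvdn_leq N0 dN) orbT.
have S1 : 0 <= divisor_sum (fun=> 1 : R) N by exact/ltW/divisor_sum1_gt0.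
have Sf : 0 <= divisor_sum f N by exact: divisor_sum_ge0.
have fE : harmonic_sum f n <= divisor_sum (fun d => f d * c d) N.
  apply: le_trans (_ : _ <= harmonic_sum (fun k => f (gcdn k N)) n) _.
    by apply: ler_harmonic_sum => k _; rewrite fa ?dvdn_gcdl.
  rewrite harmonic_sum_gcd //; apply: ler_divisor_sum => // d dN.
  by rewrite ler_wpM2l // ler_sum_coprime // leq_div.
(* Since [c] increases along divisibility, Harris' inequality is applied to [- c], which bounds the
   sum of [f * c] from above. *)
have ca : div_antitone N (fun d => - c d).
  move=> m k mk kN; rewrite lerN2 /c [leLHS]big_mkcond [leRHS]big_mkcond /=.
  apply: ler_sum => i _; case: ifP => [im|_]; last first.
    by case: ifP; rewrite ?invr_ge0.
  rewrite (coprime_dvdr _ im) //.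
  have k0 : (0 < k)%N by apply: dvdn_gt0 kN.
  move: mk kN k0 N0 => /dvdnP[a ->] /dvdnP[b ->].
  rewrite muln_gt0 => /andP[a0 m0] _.
  by rewrite mulnK ?muln_gt0 ?a0 // mulnA mulnK // dvdn_mulr.
have fN : div_antitone N f by move=> m k mk _; exact: fa.
have := divisor_sum_harris N0 fN ca.
have -> : divisor_sum (fun d => - c d) N = - divisor_sum c N.
  by rewrite /divisor_sum -sumrN; apply: eq_bigr => d _; rewrite mulNr.
have -> : divisor_sum (fun d => f d * - c d) N =
    - divisor_sum (fun d => f d * c d) N.
  by rewrite /divisor_sum -sumrN; apply: eq_bigr => d _; rewrite mulrN mulNr.
rewrite mulrN mulNr lerN2 => H.
apply: le_trans (ler_wpM2l Sf cE).
by apply: le_trans H; rewrite ler_wpM2r.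
Qed.

(** Harris' inequality is applied to [f] and the indicator of [d <= n]. Every positive [d <= n]
    divides [n!], so the divisor sums cut off at [n] are exactly harmonic sums. *)
Lemma divisor_mean_le_harmonic_sum (R : realType) (f : nat -> R) (n : nat) :
  (forall m k, (m %| k)%N -> f k <= f m) ->
  divisor_sum f n`! * harmonic_sum (fun=> 1) n <=
  harmonic_sum f n * divisor_sum (fun=> 1) n`!.
Proof.
move=> fa; have N0 := fact_gt0 n.
pose g d : R := (d <= n)%N%:R.
have gE (h : nat -> R) :
    divisor_sum (fun d => h d * g d) n`! = harmonic_sum h n.
  rewrite /divisor_sum /harmonic_sum.
  transitivity (\sum_(d <- divisors n`! | (d <= n)%N) h d / d%:R).
    rewrite [RHS]big_mkcond /=; apply: eq_bigr => d _; rewrite /g.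
    by case: leqP; rewrite ?mulr1 ?mulr0 ?mul0r.
  rewrite -big_filter; apply: perm_big; apply: uniq_perm.
  - by rewrite filter_uniq ?divisors_uniq.
  - exact: iota_uniq.
  move=> d; rewrite mem_filter mem_index_iota -dvdn_divisors // ltnS andbC.
  case: (leqP d n) => [dn|_]; rewrite ?andbF ?andbT //.
  by apply/idP/idP => [/dvdn_gt0->//|d0]; rewrite dvdn_fact // d0.
have fN : div_antitone n`! f by move=> m k mk _; exact: fa.
have gN : div_antitone n`! g.
  move=> m k mk kN; rewrite /g ler_nat.
  have := dvdn_leq (dvdn_gt0 N0 kN) mk.
  by case: (leqP k n) => // kn mk'; rewrite (leq_trans mk' kn).
have := divisor_sum_harris N0 fN gN; rewrite gE.
rewrite -(gE (fun=> 1)); congr (_ * _ <= _).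
by apply: eq_bigr => d _; rewrite mul1r.
Qed.

(** * Logarithmic growth of the harmonic sum *)

Lemma ln_le_harmonic_sum (R : realType) (n : nat) :
  (0 < n)%N -> ln n.+1%:R <= harmonic_sum (fun=> 1 : R) n <= 1 + ln n%:R.
Proof.
(* Both bounds come from [ln (1 + x) <= x], at [x = - 1 / (m + 1)] and at [x = 1 / m]. *)
have step (m : nat) : (0 < m)%N ->
    m.+1%:R^-1 <= @ln R m.+1%:R - @ln R m%:R <= m%:R^-1.
  move=> m0; have m0' : 0 < m%:R :> R by rewrite ltr0n.
  have m1 : 0 < m.+1%:R :> R by rewrite ltr0n.
  apply/andP; split.
    rewrite -[leRHS]opprB -ln_div ?posrE // lerNr.
    have -> : m%:R / m.+1%:R = 1 + - m.+1%:R^-1 :> R.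
      by rewrite -[in LHS](addrK 1 m%:R) natr1 mulrBl divff ?gt_eqF // mul1r.
    by apply: le_ln1Dx; rewrite ltrN2 invf_lt1 ?ltr1n.
  rewrite -ln_div ?posrE //.
  have -> : m.+1%:R / m%:R = 1 + m%:R^-1 :> R.
    by rewrite -natr1 mulrDl divff ?gt_eqF // mul1r.
  by apply: le_ln1Dx; rewrite (lt_trans (ltrN10 _)) ?invr_gt0.
case: n => // n _; elim: n => [|n /andP[IH1 IH2]].
  have /andP[_] := step 1%N isT.
  by rewrite /harmonic_sum big_nat1 ln1 divr1 addr0 subr0 invr1 lexx => ->.
have /andP[h1 _] := step n.+1 isT; have /andP[_ h2] := step n.+2 isT.
rewrite /harmonic_sum big_nat_recr //= -/(harmonic_sum _ _).
move: IH1 IH2 h1 h2; rewrite mul1r.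
move: (harmonic_sum _ _) (ln n.+1%:R) (ln n.+2%:R) (ln n.+3%:R) => h a b c.
by move: (n.+2%:R^-1) => i *; apply/andP; split; lra.
Qed.

Lemma near_le_ln (R : realType) (a : R) : \forall n \near \oo, a <= ln n%:R.
Proof.
near=> n; have an : expR a <= n%:R by near: n; exact: nbhs_infty_ger.
by rewrite -[a]expRK ler_ln ?posrE ?expR_gt0 // (lt_le_trans _ an) ?expR_gt0.
Unshelve. all: by end_near.
Qed.

Lemma cvg_invr_ln (R : realType) : (ln n%:R)^-1 @[n --> \oo] --> (0 : R).
Proof.
apply/cvgrPdist_le => e e0; near=> n.
have en : e^-1 <= ln n%:R by near: n; exact: near_le_ln.
have ln0 : 0 < ln n%:R :> R by rewrite (lt_le_trans _ en) ?invr_gt0.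
rewrite sub0r normrN ger0_norm ?invr_ge0 ?(ltW ln0) //.
by rewrite -[e]invrK lef_pV2 ?posrE ?invr_gt0.
Unshelve. all: by end_near.
Qed.

Definition harmonic_ratio (R : realType) (f : nat -> R) (n : nat) : R :=
  (ln n%:R)^-1 * harmonic_sum f n.

Lemma cvg_harmonic_ratio1 (R : realType) :
  harmonic_ratio (fun=> 1 : R) @ \oo --> (1 : R).
Proof.
apply: (@squeeze_cvgr _ _ _ _ (cst 1) (fun n => (ln n%:R)^-1 + 1)).
- near=> n; have l0 : 1 <= ln n%:R :> R by near: n; exact: near_le_ln.
  have l1 : 0 < ln n%:R :> R by rewrite (lt_le_trans ltr01).
  have n0 : (0 < n)%N by near: n; exact: nbhs_infty_gt.
  have /andP[h1 h2] := ln_le_harmonic_sum R n0.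
  rewrite /harmonic_ratio [cst _ _]/(1 : R) mulrC ler_pdivlMr // mul1r.
  rewrite ler_pdivrMr // mulrDl mulVf ?gt_eqF // mul1r h2 andbT.
  by rewrite (le_trans _ h1) // ler_ln ?posrE ?ltr0n // ler_nat.
- exact: cvg_cst.
- by rewrite -[X in _ --> X]add0r; apply: cvgD (cvg_cst _); exact: cvg_invr_ln.
Unshelve. all: by end_near.
Qed.

(** * Null divisor-closed sets and their intersections *)

Definition divisor_closed (D : set nat) : Prop :=
  forall m n, (m %| n)%N -> D n -> D m.

Definition log_null (R : realType) (D : set nat) : Prop :=
  harmonic_ratio (\1_D : nat -> R) @ \oo --> (0 : R).

(* For a divisor-closed set, the proportion bounded here is nonincreasing in [N]
   for divisibility; it tends to the logarithmic density. *)
Definition divisor_null (R : realType) (D : set nat) : Prop :=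
  forall e : R, 0 < e -> exists2 N, (0 < N)%N &
    divisor_sum \1_D N <= e * divisor_sum (fun=> 1) N.

Lemma indic_antitone (R : realType) (D : set nat) : divisor_closed D ->
  forall m n, (m %| n)%N -> \1_D n <= \1_D m :> R.
Proof.
move=> cD m n mn; rewrite !indicE ler_nat.
case: (asboolP (D n)) => [Dn|nDn].
  by rewrite !mem_set //; exact: cD Dn.
by rewrite (memNset nDn).
Qed.

(** Forwards, a small harmonic ratio at [n] gives a small proportion among the divisors of [n!].
    Backwards, a small proportion for one fixed [N] bounds the harmonic sums for all large [n]. *)
Lemma log_nullP (R : realType) (D : set nat) : divisor_closed D ->
  log_null R D <-> divisor_null R D.
Proof.
move=> cD; have fa := @indic_antitone R D cD.
have f0 k : 0 <= \1_D k :> R by rewrite indicE.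
split=> [nD e e0|nD].
  have [n [n0 l0 he]] : exists n, [/\ (0 < n)%N, 0 < @ln R n%:R &
      harmonic_ratio \1_D n <= e].
    near \oo => n; exists n.
    have l1 : 1 <= ln n%:R :> R by near: n; exact: near_le_ln.
    split; first by near: n; exact: nbhs_infty_gt.
      by rewrite (lt_le_trans ltr01).
    near: n; move/cvgrPdist_le: nD => /(_ e e0); apply: filterS => n.
    by rewrite sub0r normrN; apply: le_trans; exact: ler_norm.
  exists n`!; first exact: fact_gt0.
  have /andP[h1 _] := ln_le_harmonic_sum R n0.
  have l1 : ln n%:R <= harmonic_sum (fun=> 1) n :> R.
    by rewrite (le_trans _ h1) // ler_ln ?posrE ?ltr0n // ler_nat.
  have h0 : 0 < harmonic_sum (fun=> 1) n :> R by exact: lt_le_trans l1.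
  rewrite -(ler_pM2r h0) (le_trans (divisor_mean_le_harmonic_sum n fa)) //.
  rewrite mulrAC ler_wpM2r ?(ltW (divisor_sum1_gt0 _ (fact_gt0 _))) //.
  rewrite (le_trans _ (ler_wpM2l (ltW e0) l1)) //.
  by move: he; rewrite /harmonic_ratio mulrC ler_pdivrMr.
apply/cvgrPdist_le => e e0.
have e20 : 0 < e / 2 by rewrite divr_gt0.
have [N N0 hN] := nD (e / 2) e20.
near=> n.
have n0 : (0 < n)%N by near: n; exact: nbhs_infty_gt.
(* This makes the harmonic sum up to [n * N] at most [2 * ln n]; the factor 2 is absorbed by the
   choice of [e / 2]. *)
have l1 : 1 + ln N%:R <= ln n%:R :> R by near: n; exact: near_le_ln.
have l0 : 1 <= ln n%:R :> R by near: n; exact: near_le_ln.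
have {}l0 : 0 < ln n%:R :> R by rewrite (lt_le_trans ltr01).
rewrite sub0r normrN ger0_norm; last first.
  by rewrite mulr_ge0 ?invr_ge0 ?(ltW l0) // harmonic_sum_ge0.
rewrite /harmonic_ratio mulrC ler_pdivrMr //.
have S0 := divisor_sum1_gt0 R N0.
have := harmonic_sum_le_divisor_mean n N0 f0 fa.
move=> /le_trans/(_ (ler_wpM2r (harmonic_sum_ge0 _ (fun=> ler01)) hN)).
rewrite mulrAC ler_pM2r // => /le_trans; apply.
have nN0 : (0 < n * N)%N by rewrite muln_gt0 n0.
have /andP[_ h2] := ln_le_harmonic_sum R nN0.
rewrite natrM lnM ?posrE ?ltr0n // in h2.
rewrite -mulrA ler_wpM2l ?(ltW e0) // mulrC ler_pdivrMr // (le_trans h2) //.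
move: l1; move: (ln N%:R) (ln n%:R) => a b; lra.
Unshelve. all: by end_near.
Qed.

Lemma divisor_null_sub (R : realType) (D1 D2 : set nat) :
  D1 `<=` D2 -> divisor_null R D2 -> divisor_null R D1.
Proof.
move=> D12 n2 e e0; have [N N0 hN] := n2 e e0; exists N => //.
apply: le_trans hN; apply: ler_divisor_sum => // d _; rewrite !indicE ler_nat.
case: (asboolP (D1 d)) => [D1d|nD]; last by rewrite (memNset nD).
by rewrite !mem_set //; exact: D12.
Qed.

(** If neither set is null, their proportions exceed some [e1] and [e2] for every [N]; by Harris'
    inequality that of the intersection exceeds [e1 * e2]. *)
Lemma divisor_nullI (R : realType) (D1 D2 : set nat) :
  divisor_closed D1 -> divisor_closed D2 ->
  divisor_null R (D1 `&` D2) -> divisor_null R D1 \/ divisor_null R D2.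
Proof.
move=> c1 c2 n12; apply: contrapT => /not_orP[].
move=> /existsNP[e1 /not_implyP[e10 H1]] /existsNP[e2 /not_implyP[e20 H2]].
have [N N0] := n12 (e1 * e2) (mulr_gt0 e10 e20); apply/negP; rewrite -ltNge.
have S0 := divisor_sum1_gt0 R N0.
have h1 : e1 * divisor_sum (fun=> 1) N < divisor_sum \1_D1 N.
  by rewrite ltNge; apply/negP => h; apply: H1; exists N.
have h2 : e2 * divisor_sum (fun=> 1) N < divisor_sum \1_D2 N.
  by rewrite ltNge; apply/negP => h; apply: H2; exists N.
rewrite -(ltr_pM2r S0); apply: lt_le_trans (_ : _ < divisor_sum \1_D1 N *
    divisor_sum \1_D2 N) _.
  set S := divisor_sum (fun=> 1) N in S0 h1 h2 *.
  have -> : e1 * e2 * S * S = (e1 * S) * (e2 * S) by ring.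
  by apply: ltr_pM => //; rewrite ltW ?mulr_gt0.
rewrite indicI; apply: divisor_sum_harris => // m n mn _; exact: indic_antitone.
Qed.

Lemma divisor_null_setT (R : realType) : ~ divisor_null R setT.
Proof.
move=> /(_ 2^-1); rewrite invr_gt0 ltr0n => /(_ isT)[N N0]; rewrite indicT.
have := divisor_sum1_gt0 R N0; rewrite -[cst 1]/(fun=> 1).
move: (divisor_sum _ _) => s; lra.
Qed.

(** With [D i] the integers free of divisors in a set [A i], this says that if a finite union has
    multiples of density 1, so does one of its members. The empty intersection is everything, which
    is not null. *)
Lemma divisor_null_bigcap (R : realType) (s : seq nat) (D : nat -> set nat) :
  (forall i, divisor_closed (D i)) ->
  divisor_null R [set n | forall i, i \in s -> D i n] ->
  exists2 i, i \in s & divisor_null R (D i).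
Proof.
move=> cD; elim: s => [|i s IH] nD.
  by case: (@divisor_null_setT R); apply: divisor_null_sub nD.
have [|||ni|ns] := @divisor_nullI R (D i) [set n | forall j, j \in s -> D j n].
- exact: cD.
- by move=> m n mn Dn j js; apply: cD mn _; exact: Dn.
- apply: divisor_null_sub nD => n [Di Ds] j; rewrite inE => /predU1P[->//|].
  exact: Ds.
- by exists i; rewrite ?mem_head.
- by case: (IH ns) => j js nj; exists j; rewrite // inE js orbT.
Qed.

(** * Sets of multiples and logarithmic density *)

Definition free_of (A : set nat) : set nat :=
  [set n | forall a, A a -> ~~ (a %| n)%N].

Lemma divisor_closed_free_of (A : set nat) : divisor_closed (free_of A).
Proof.
by move=> m n mn fn a Aa; apply: contra (fn a Aa) => am; exact: dvdn_trans mn.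
Qed.

(** Multiples of [q] take up at most [1 / q <= 1 / 2] of each harmonic sum, so a null complement
    would give [1 / 2 <= 0] in the limit. *)
Lemma free_of1_not_null (R : realType) (q : nat) :
  (1 < q)%N -> ~ divisor_null R (free_of [set q]).
Proof.
move=> q1 /(log_nullP _ (@divisor_closed_free_of _)) nq.
have hq n : 2^-1 * harmonic_sum (fun=> 1 : R) n <=
    harmonic_sum \1_(free_of [set q]) n.
  have -> : harmonic_sum (\1_(free_of [set q]) : nat -> R) n =
      harmonic_sum (fun=> 1) n - \sum_(1 <= k < n.+1 | (q %| k)%N) k%:R^-1.
    rewrite /harmonic_sum [X in _ - X]big_mkcond -sumrB; apply: eq_bigr => k _.
    rewrite indicE; case: ifP => qk; last first.
      by rewrite subr0 mem_set // => _ ->; rewrite qk.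
    by rewrite memNset ?mul0r ?mul1r ?subrr // => /(_ q erefl); rewrite qk.
  under [X in _ - X]eq_bigl => k do rewrite -[(q %| k)%N]andbT.
  rewrite big_nat_multiples ?(ltnW q1) //.
  under [X in _ - X]eq_bigr do rewrite natrM invfM.
  rewrite -mulr_sumr; set s := \sum_(_ <= _ < _) _.
  have sn : s <= harmonic_sum (fun=> 1) n.
    apply: le_trans (harmonic_sum_homo (fun=> ler01) (leq_div n q)).
    by rewrite /s /harmonic_sum; apply: ler_sum => k _; rewrite mul1r.
  have q2 : q%:R^-1 <= 2^-1 :> R.
    by rewrite lef_pV2 ?posrE ?ltr0n ?(ltnW q1) // ler_nat.
  have s0 : 0 <= s by rewrite /s sumr_ge0 // => k _; rewrite invr_ge0.
  have := ler_wpM2r s0 q2; move: (harmonic_sum _ _) sn => h; lra.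
have c1 : 2^-1 * harmonic_ratio (fun=> 1 : R) n @[n --> \oo] --> (2^-1 * 1 : R).
  by apply: cvgM; [exact: cvg_cst | exact: cvg_harmonic_ratio1].
have : 2^-1 * 1 <= 0 :> R; last by lra.
apply: ler_cvg_to c1 nq _; near=> n; rewrite /harmonic_ratio mulrCA.
rewrite ler_wpM2l ?invr_ge0 //; near: n; exact: near_le_ln.
Unshelve. all: by end_near.
Qed.

Lemma multiples_nat (B : set nat) (k : nat) :
  (k%:Z \in multiples B) = (k \notin free_of B).
Proof.
apply/idP/idP.
  rewrite inE => -[b Bb [z _ e]]; apply/negP.
  rewrite inE => /(_ b Bb)/negP; apply.
  have : (b%:Z %| k%:Z)%Z by rewrite -e dvdz_mulr.
  by rewrite dvdzE !absz_nat.
rewrite notin_setE => /existsNP[b /not_implyP[Bb /negP]]; rewrite negbK.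
case/dvdnP=> m ->; rewrite inE; exists b => //; exists m%:Z => //.
by rewrite mulnC PoszM.
Qed.

Lemma logmeanE (R : realType) (B : set nat) (n : nat) :
  logmean R (multiples B) n =
  harmonic_ratio (fun=> 1) n - harmonic_ratio \1_(free_of B) n.
Proof.
rewrite /logmean /harmonic_ratio -mulrBr; congr (_ * _).
rewrite /harmonic_sum -sumrB big_mkcond /=; apply: eq_bigr => k _.
rewrite multiples_nat indicE; case: (_ \in _) => /=; first by rewrite subrr.
by rewrite mul0r subr0 mul1r.
Qed.

Lemma Behrend_divisor_null (R : realType) (A : set nat) :
  Behrend R A -> divisor_null R (free_of A).
Proof.
case=> _ dA; apply/log_nullP; first exact: divisor_closed_free_of.
(* The junk value of [lim] on a divergent sequence is [0], so a logarithmic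
   density equal to [1] is a genuine limit. *)
have /cvgNpoint : lim (logmean R (multiples A) @ \oo) != point.
  by rewrite -/(logdensity R _) dA oner_eq0.
rewrite -/(logdensity R _) dA => c1.
have /cvgB/(_ c1) := @cvg_harmonic_ratio1 R; rewrite subrr.
apply: cvg_trans; apply: near_eq_cvg; near=> n.
change (harmonic_ratio (fun=> 1 : R) n - logmean R (multiples A) n =
  harmonic_ratio \1_(free_of A) n).
by rewrite logmeanE opprB addrC subrK.
Unshelve. all: by end_near.
Qed.

Lemma logdensity_eq (R : realType) (A B : set int) :
  (fun n => logmean R A n - logmean R B n) @ \oo --> (0 : R) ->
  logdensity R A = logdensity R B.
Proof.
move=> AB0; rewrite /logdensity.
have BA0 : (fun n => logmean R B n - logmean R A n) @ \oo --> (0 : R).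
  have /cvgN := AB0; rewrite oppr0; apply: cvg_trans; apply: near_eq_cvg.
  by near=> n; rewrite fctE opprB.
(* If one of the two sequences diverges then so does the other, and both sides
   are the same junk value of [lim]. *)
have [cA|cA] := pselect (cvg (logmean R A @ \oo)).
  by apply/esym/cvg_lim => //; exact: (cvg_sub0 BA0).
have [cB|cB] := pselect (cvg (logmean R B @ \oo)).
  by case: cA; apply/cvg_ex; eexists; exact: (cvg_sub0 AB0 cB).
by rewrite (dvgP cA) (dvgP cB).
Unshelve. all: by end_near.
Qed.

Lemma invr_ln_nat_ge0 (R : realType) (n : nat) : 0 <= (ln (n%:R : R))^-1.
Proof.
rewrite invr_ge0; have [->|n0] := posnP n; first by rewrite ln0.
by rewrite ln_ge0 // ler1n.
Qed.

Lemma log_null_sandwich (R : realType) (u : nat -> R) (D : set nat) :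
  (forall n, 0 <= u n) -> (forall n, u n <= harmonic_ratio \1_D n) ->
  log_null R D -> u @ \oo --> (0 : R).
Proof.
move=> u0 uD nD; apply: (squeeze_cvgr _ (cvg_cst 0) nD).
by near=> n; apply/andP; split; [exact: u0 | exact: uD].
Unshelve. all: by end_near.
Qed.

(* An integer that is a multiple of [d * q0] but of no other element of [E] is
   [d] times an element free of all the other quotients of [E] by [d]. *)
Lemma logdensity_setD1 (R : realType) (E : set nat) (d q0 : nat) :
  (0 < d)%N -> E (d * q0)%N ->
  divisor_null R (free_of ([set q | E (d * q)%N] `\ q0)) ->
  logdensity R (multiples (E `\ (d * q0)%N)) = logdensity R (multiples E).
Proof.
move=> d0 Eq0 nF; set F := free_of _ in nF.
have cF : divisor_closed F by exact: divisor_closed_free_of.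
apply/esym/logdensity_eq; apply: (@log_null_sandwich R _ F); last first.
- exact/log_nullP.
- move=> n; rewrite !logmeanE opprB addrC addrA addrNK /harmonic_ratio -mulrBr.
  rewrite ler_wpM2l ?invr_ln_nat_ge0 //.
  apply: le_trans (harmonic_sum_homo _ (leq_div n d)); last first.
    by move=> k; rewrite indicE.
  (* The integers [k] lost by the removal are [d] times elements of [F]; writing [k = d * m], the
     bound uses [1 / (d * m) <= 1 / m]. *)
  apply: le_trans (_ : _ <=
      \sum_(1 <= k < n.+1 | (d %| k)%N && (k %/ d \in F)%N) k%:R^-1) _;
    last first.
    rewrite big_nat_multiples // big_mkcond.
    apply: ler_sum_nat => k /andP[k0 _].
    rewrite mulKn // indicE; case: ifP => _; last by rewrite mul0r.
    by rewrite mul1r lef_pV2 ?posrE ?ltr0n ?muln_gt0 ?d0 // ler_nat leq_pmull.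
  rewrite /harmonic_sum -sumrB [leRHS]big_mkcond; apply: ler_sum => k _.
  rewrite -mulrBl !indicE; case: ifP => dk.
    rewrite ler_piMl ?invr_ge0 // lerBlDr.
    by case: (k \in _) => //=; rewrite ?lerDl ?addr_ge0.
  (* Otherwise no [k] is lost: an element of [E] dividing [k] could only be [d * q0], and then [d]
     divides [k] with quotient in [F]. *)
  rewrite mulr_le0_ge0 ?invr_ge0 // subr_le0 ler_nat.
  have [|//] := boolP (k \in free_of (E `\ _)); rewrite inE => fk.
  rewrite mem_set // => e Ee; apply/negP => ek.
  have [ee|/eqP ee] := eqVneq e (d * q0)%N; last first.
    by have /negP := fk e (conj Ee ee).
  have dvk : (d %| k)%N by apply: dvdn_trans ek; rewrite ee dvdn_mulr.
  move: dk; rewrite dvk /= => /negP; apply.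
  rewrite inE => q [/= Eq qq0]; apply/negP => qk.
  have /negP[] : ~~ (d * q %| k)%N.
    by apply: fk; split => //= /eqP; rewrite eqn_pmul2l // => /eqP.
  by rewrite -(divnK dvk) mulnC dvdn_mul.
- move=> n; rewrite !logmeanE opprB addrC addrA addrNK /harmonic_ratio -mulrBr.
  rewrite mulr_ge0 ?invr_ln_nat_ge0 //.
  rewrite subr_ge0; apply: ler_harmonic_sum => k _; rewrite !indicE ler_nat.
  have [|//] := boolP (k \in free_of E); rewrite inE => fk.
  by rewrite mem_set // => e [Ee _]; exact: fk.
Qed.

(** * Taut sets and Behrend cofactors *)

Lemma taut_dvdn_eq (R : realType) (E : set nat) (e e' : nat) :
  taut R E -> E e -> E e' -> (e' %| e)%N -> e' = e.
Proof.
move=> tE Ee Ee' ee'; apply: contrapT => ne.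
(* Multiples of [e] are already multiples of [e'], so removing [e] would change nothing. *)
suff EE : multiples (E `\ e) = multiples E by have := tE e Ee; rewrite EE ltxx.
apply/seteqP; split=> z [b].
  by move=> [Eb _] bz; exists b.
have [-> _ [w _ <-]|/eqP be Eb bz] := eqVneq b e; last by exists b.
exists e'; first by [].
exists ((e %/ e')%N%:Z * w) => //.
by rewrite mulrA -PoszM mulnC divnK.
Qed.

(** This provides a divisor in [E] for every Behrend cofactor of a set consisting of multiples of
    elements of [E]. *)
Lemma taut_dilate_Behrend (R : realType) (E A : set nat) (c : nat) :
  E `<=` posnat -> taut R E -> (0 < c)%N -> Behrend R A ->
  (forall a, A a -> exists2 e, E e & (e %| c * a)%N) ->
  exists2 e, E e & (e %| c)%N.
Proof.
move=> E0 tE c0 bA cA; apply: contrapT => nc.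
pose Q d : set nat := [set q | E (d * q)%N].
have [||d dc nQ] :=
  @divisor_null_bigcap R (divisors c) (fun d => free_of (Q d)).
- by move=> d; exact: divisor_closed_free_of.
(* An [n] free of every [Q d] is free of [A]: if [a] divides [n] and [e] divides [c * a], then with
   [d = gcdn e c] the quotient [e %/ d] lies in [Q d] and divides [a]. *)
- apply: divisor_null_sub (Behrend_divisor_null bA) => n fn a Aa.
  apply/negP => an; have [e Ee eca] := cA a Aa.
  have e0 : (0 < e)%N := E0 e Ee.
  have g0 : (0 < gcdn e c)%N by rewrite gcdn_gt0 e0.
  have gE : (gcdn e c * (e %/ gcdn e c))%N = e.
    by rewrite mulnC divnK ?dvdn_gcdl.
  have /fn/(_ (e %/ gcdn e c)%N) : gcdn e c \in divisors c.
    by rewrite -dvdn_divisors // dvdn_gcdr.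
  rewrite /Q /= gE => /(_ Ee)/negP; apply; apply: dvdn_trans an.
  have cop : coprime (e %/ gcdn e c) (c %/ gcdn e c).
    rewrite /coprime -(eqn_pmul2l g0) muln_gcdr gE muln1.
    by rewrite mulnC divnK ?dvdn_gcdr.
  rewrite -(Gauss_dvdr _ cop) -(dvdn_pmul2l g0) gE mulnA.
  by rewrite [(gcdn e c * (c %/ _))%N]mulnC divnK ?dvdn_gcdr.
rewrite -dvdn_divisors // in dc.
have d0 : (0 < d)%N by exact: dvdn_gt0 dc.
have [[q0 Qq0]|Q0] := pselect (exists q, Q d q); last first.
  apply: (@divisor_null_setT R); apply: divisor_null_sub nQ => n _ q Qq.
  by case: Q0; exists q.
(* If [q0 = 1], then [d] would be an element of [E] dividing [c]. *)
have q1 : (1 < q0)%N.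
  rewrite ltn_neqAle eq_sym; apply/andP; split.
    by apply/eqP => q1; apply: nc; exists (d * q0)%N; rewrite // q1 muln1.
  by have := E0 _ Qq0; rewrite /posnat /= muln_gt0 d0.
(* The integers free of [q0] alone are not null, so those free of the rest of [Q d] are; removing
   [d * q0] from [E] then keeps the density. *)
have [|||n1|n1] := @divisor_nullI R (free_of (Q d `\ q0)) (free_of [set q0]).
- exact: divisor_closed_free_of.
- exact: divisor_closed_free_of.
- apply: divisor_null_sub nQ => n [f1 f2] q Qq.
  by have [->|/eqP qq0] := eqVneq q q0; [exact: f2 | exact: f1].
- by have := tE _ Qq0; rewrite (logdensity_setD1 d0 Qq0 n1) ltxx.
- exact: free_of1_not_null n1.
Qed.

Theorem theorem1p9 (R : realType) (E A : nat -> set nat)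
    (hE : forall i, (1 <= i)%N -> E i `<=` posnat)
    (htaut : taut R (\bigcup_(i in [set i | (1 <= i)%N]) E i))
    (hA : forall i, (1 <= i)%N -> Behrend R (A i)) :
  tautification R (\bigcup_(i in [set i | (1 <= i)%N]) prodset (E i) (A i)) =
  \bigcup_(i in [set i | (1 <= i)%N]) E i.
Proof.
set U := \bigcup_(i in _) E i in htaut *; set B := \bigcup_(i in _) _.
have U0 : U `<=` posnat by move=> e [i i1 Ee]; exact: hE i1 _ Ee.
have UC : U `<=` Behrend_cofactors R B.
  move=> e Ue; split; first exact: U0.
  case: Ue => i i1 Ee; exists (A i); first exact: hA.
  by move=> _ [a Aa <-]; exists i => //; exists e => //; exists a.
have BU b : B b -> exists2 e, U e & (e %| b)%N.
  move=> [i i1 [e Ee [a Aa <-]]]; exists e; first by exists i.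
  exact: dvdn_mulr.
have CU c : (B `|` Behrend_cofactors R B) c -> exists2 e, U e & (e %| c)%N.
  case=> [/BU //|[c0 [A' bA' cA']]].
  apply: (taut_dilate_Behrend U0 htaut c0 bA') => a A'a.
  by apply: BU; apply: cA'; exists a.
apply/seteqP; split=> x.
  move=> [BCx nx]; have [e Ue /dvdnP[k xE]] := CU x BCx.
  (* Positivity excludes the cofactor [k = 0]; for [x] in [B] it needs the elements of [A i] to be
     positive. *)
  have x0 : (0 < x)%N.
    case: BCx => [[i i1 [e' Ee' [a Aa <-]]]|[]//].
    rewrite muln_gt0 (hE i i1 _ Ee') /=.
    by have [/(_ a Aa)[]] := hA i i1.
  have [k2|k1] := leqP 2 k.
    by case: nx; exists k => //; exists e => //; right; exact: UC.
  have : k = 1%N by move: x0; rewrite xE muln_gt0; lia.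
  by move=> k1'; rewrite xE k1' mul1n.
move=> Ux; split; first by right; exact: UC.
(* If [x = k * y] with [k >= 2], some [e] in [U] divides [y], hence [x]; tautness forces [e = x], so
   [x <= y < x]. *)
move=> [k /= k2 [y /CU[e Ue ey] yx]].
have ex : e = x by apply: (taut_dvdn_eq htaut Ux Ue); rewrite -yx dvdn_mull.
have x0 : (0 < x)%N := U0 x Ux.
have y0 : (0 < y)%N by move: x0; rewrite -yx muln_gt0 => /andP[].
have := dvdn_leq y0 ey; rewrite ex -yx; nia.
Qed.
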